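(* For every integer $n\ge 0$ and every real $x$, $$\sum_{k=0}^{n}B_k^n(x)=1,$$ where $B_k^n$ denotes the Bernstein basis function.
   Context: The Bernstein basis functions are $B_k^n(x)=\binom{n}{k}x^k(1-x)^{n-k}$ for integers $0\le k\le n$ (with $0^0=1$). *)

(* Defs.v *)
From mathcomp Require Import all_boot all_algebra.
From mathcomp Require Import reals.

Set Implicit Arguments.
Unset Strict Implicit.
Unset Printing Implicit Defensive.

Import GRing.Theory.

Local Open Scope ring_scope.

(* B_k^n(x), meant for k <= n; for n < k it is 0, since 'C(n, k) = 0.
   [_ ^+ 0] is 1 even at 0, so the convention 0^0 = 1 is built in. *)
Definition bernstein (R : realType) (n k : nat) (x : R) : R :=
  'C(n, k)%:R * x ^+ k * (1 - x) ^+ (n - k).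

(* Main.v *)
Require Import Defs.
From mathcomp Require Import all_boot all_algebra.
From mathcomp Require Import reals.

Local Open Scope ring_scope.

(** The sum is the binomial expansion ([exprDn]) of [((1 - x) + x) ^+ n], whose base is 1. *)

Theorem theorem2 (R : realType) (n : nat) (x : R) :
  \sum_(k < n.+1) bernstein n k x = 1.
Proof.
(* With [1 - x] as first summand, [exprDn] gives it the exponent [n - k] and gives [x] the exponent
   [k], so the two sums match term by term. [bernstein] is still folded, so its own [1] is not
   rewritten. *)
rewrite -[RHS](GRing.expr1n _ n) -(GRing.subrK x 1) GRing.exprDn.
apply: eq_bigr => k _.
by rewrite /bernstein -GRing.mulrA GRing.mulr_natl (GRing.mulrC (x ^+ k)).
Qed.
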